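(* Consider the equation $$-\partial_x\nabla_vE(u,u')+\nabla_uE(u,u')+DS(u)^T\,K*S(u)=0 \qquad (\ast)$$ and the function $$\mathcal H(u):=-\Big(E(u,u')-\nabla_vE(u,u')\cdot u'+\tfrac12S(u)\cdot K*S(u)\Big)\Big|_{x=0}+\tfrac12\iint_Q\Big(S(u(x))\cdot K(x-y)DS(u(y))u'(y)-S(u(y))\cdot K(x-y)DS(u(x))u'(x)\Big)dx\,dy,$$ where $Q:=(-\infty,0)\times(0,\infty)$. The quantity $\mathcal H$ is conserved under the shift action $\phi_\tau u(x)=u(x+\tau)$ on solutions of $(\ast)$: for any $u\in C^R_b(\mathbb R,\mathbb R^d)$ solving $(\ast)$, $$\frac{d}{d\tau}\mathcal H(\phi_\tau u)=0\quad\text{for all }\tau\in\mathbb R.$$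
   Context: $\mathcal M(\mathbb R^d)$ denotes real $d\times d$ matrices. The kernel $K:\mathbb R\to\mathcal M(\mathbb R^d)$ satisfies $K(r)=K(-r)$, $K(r)=K(r)^T$, $K\in L^1(\mathbb R,\mathcal M(\mathbb R^d))$, and $\int_{\mathbb R}(1+|r|)\|K(r)\|\,dr<\infty$. $S\in C^2(\mathbb R^d,\mathbb R^d)$, $E=E(u,v)\in C^2(\mathbb R^d\times\mathbb R^d,\mathbb R)$, and $K*S(u)(x)=\int_{\mathbb R}K(x-y)S(u(y))\,dy$. Set $R=1$ if $\nabla_vE\equiv0$ and $R=2$ otherwise; solutions are taken of class $C^R$. $C^k_b(\mathbb R,\mathbb R^d)$ is the space of $C^k$ functions which are uniformly bounded together with their first $k$ derivatives. *)

(* Defs.v *)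
From mathcomp Require Import all_boot all_order all_algebra.
From mathcomp Require Import all_classical all_reals all_analysis.

Set Implicit Arguments.
Unset Strict Implicit.
Unset Printing Implicit Defensive.

Import Order.TTheory GRing.Theory Num.Theory.
Import numFieldNormedType.Exports.

Local Open Scope ring_scope.
Local Open Scope classical_set_scope.

(* Class C^k, for V finite-dimensional: the differential is then a C^(k-1) map
   into Hom(V, W) iff each of its values x |-> 'd f x v is a C^(k-1) map. *)
Fixpoint class_C (R : realType) (V W : normedModType R) (k : nat) (f : V -> W)
    : Prop :=
  match k with
  | 0 => continuous f
  | k'.+1 => (forall x, differentiable f x) /\
             forall v, class_C k' (fun x => 'd f x v)
  end.

Definition class_Cb (R : realType) (V : normedModType R) (k : nat) (u : R -> V)
    : Prop :=
  [/\ forall j x, (j < k)%N -> derivable (derive1n j u) x 1,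
      continuous (derive1n k u) &
      forall j, (j <= k)%N -> bounded_fun (derive1n j u)].

Definition dotp (R : realType) (d : nat) (v w : 'cV[R]_d) : R :=
  \sum_(i < d) v i 0 * w i 0.

Definition grad (R : realType) (d : nat) (f : 'cV[R]_d -> R) (v : 'cV[R]_d)
    : 'cV[R]_d :=
  \col_i 'D_(delta_mx i 0) f v.

Definition grad_u (R : realType) (d : nat) (E : 'cV[R]_d * 'cV[R]_d -> R)
    (u v : 'cV[R]_d) : 'cV[R]_d :=
  grad (fun w => E (w, v)) u.

Definition grad_v (R : realType) (d : nat) (E : 'cV[R]_d * 'cV[R]_d -> R)
    (u v : 'cV[R]_d) : 'cV[R]_d :=
  grad (fun w => E (u, w)) v.

(* The library's 'J acts on row vectors and is the transpose of this matrix. *)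
Definition jac (R : realType) (d : nat) (S : 'cV[R]_d -> 'cV[R]_d)
    (v : 'cV[R]_d) : 'M[R]_d :=
  \matrix_(i, j) ('D_(delta_mx j 0) S v) i 0.

(* The norm on matrices is the library's sup norm of the entries; the integral
   conditions are the same for any other norm on the finite-dimensional space
   of matrices. *)
Definition kernel_hyp (R : realType) (d : nat) (K : R -> 'M[R]_d) : Prop :=
  [/\ forall r, K (- r) = K r,
      forall r, (K r)^T = K r,
      forall i j, (@lebesgue_measure R).-integrable setT
                    (fun r => (K r i j)%:E) &
      (\int[@lebesgue_measure R]_r ((1 + `|r|) * `|K r|)%:E < +oo)%E].

Definition kernel_conv (R : realType) (d : nat) (K : R -> 'M[R]_d) (f : R -> 'cV[R]_d)
    (x : R) : 'cV[R]_d :=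
  \col_i \int[@lebesgue_measure R]_y ((K (x - y) *m f y) i 0).

Definition regE (R : realType) (d : nat) (E : 'cV[R]_d * 'cV[R]_d -> R) : nat :=
  if `[< forall u v, grad_v E u v = 0 >] then 1%N else 2%N.

Definition solves (R : realType) (d : nat) (E : 'cV[R]_d * 'cV[R]_d -> R)
    (S : 'cV[R]_d -> 'cV[R]_d) (K : R -> 'M[R]_d) (u : R -> 'cV[R]_d) : Prop :=
  forall x : R,
    - derive1 (fun y => grad_v E (u y) (derive1 u y)) x
    + grad_u E (u x) (derive1 u x)
    + (jac S (u x))^T *m kernel_conv K (S \o u) x = 0.

Definition Hamiltonian (R : realType) (d : nat) (E : 'cV[R]_d * 'cV[R]_d -> R)
    (S : 'cV[R]_d -> 'cV[R]_d) (K : R -> 'M[R]_d) (u : R -> 'cV[R]_d) : R :=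
  - (E (u 0, derive1 u 0) - dotp (grad_v E (u 0) (derive1 u 0)) (derive1 u 0)
     + 2^-1 * dotp (S (u 0)) (kernel_conv K (S \o u) 0))
  + 2^-1 * \int[(@lebesgue_measure R \x @lebesgue_measure R)%E]_(z in
               `]-oo, (0 : R)[%classic `*` `](0 : R), +oo[%classic)
      (dotp (S (u z.1)) (K (z.1 - z.2) *m (jac S (u z.2) *m derive1 u z.2))
       - dotp (S (u z.2)) (K (z.1 - z.2) *m (jac S (u z.1) *m derive1 u z.1))).

Definition shift_by (R : realType) (d : nat) (tau : R) (u : R -> 'cV[R]_d)
    : R -> 'cV[R]_d :=
  fun x => u (x + tau).

(* Main.v *)
Require Import Defs.
From mathcomp Require Import all_boot all_order all_algebra.
From mathcomp Require Import all_classical all_reals all_analysis.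
From mathcomp Require Import measurable_realfun.
From mathcomp Require Import ring lra.
Import Order.TTheory GRing.Theory Num.Theory.
Import numFieldNormedType.Exports.
Local Open Scope ring_scope.
Local Open Scope classical_set_scope.

(** Write s = S o u and s' = DS(u) u' for the derivative of s, and let
    L = E(u,u') - grad_v E(u,u').u'.  By the usual computation for
    Euler-Lagrange equations, L' = (grad_u E - (grad_v E)') . u' along any u;
    the equation turns this into L' = - (K*s).s' ([is_derive_local]).  So
    conservation amounts to the statement that the two nonlocal terms of H,
    evaluated on the shifts of u, have derivative - (K*s).s'
    ([is_derive_nonlocal]).

    On the shift by t the double integral is J(t), the integral of
      g(x,y) = s(x).K(x-y)s'(y) - s(y).K(x-y)s'(x)
    over the quadrant x < t < y.  Moving the corner of the quadrant along the
    diagonal sweeps the vertical half-line above (t,t) and uncovers the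
    horizontal half-line to the left of it.  Since K is even, g is
    antisymmetric, and the two half-lines fold into one full line:
      J'(t) = int_R g(t,y) dy = s(t).(K*s')(t) - s'(t).(K*s)(t).
    On the other hand (s.(K*s))' = s'.(K*s) + s.(K*s'), so that
    (- s.(K*s)/2 + J/2)' = - s'.(K*s).

    As K and s' cannot be differentiated, J' is computed in the coordinates
    x and r = y - x.  This shear preserves the area and maps the quadrant to
    the strip r > 0, t - r < x < t, whence
      J(t) = int_(r > 0) K(r) (int_(t-r)^t psi_r(x) dx) dr,
      psi_r(x) = s(x) s'(x+r) - s(x+r) s'(x).
    The strip has length r over r, so the first moment of K makes everything
    converge, and the inner integral has the derivative psi_r(t) - psi_r(t-r),
    bounded uniformly in r, so the integrability of K allows differentiation
    under the integral ([is_derive_crossing]).  This asks only for continuity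
    and boundedness of s', which is what remains when u is merely of
    class C^1.  Boundedness of s and s' follows from that of u and u' by
    compactness of closed balls.  The computation is carried out for each
    entry of K separately. *)

Set Implicit Arguments.
Unset Strict Implicit.
Unset Printing Implicit Defensive.

(** * Measure-preserving changes of variable *)
Lemma lebesgue_measure_shift (R : realType) (c : R) (A : set R) :
  measurable A ->
  pushforward lebesgue_measure (fun x => x + c : measurableTypeR R) A
    = lebesgue_measure A.
Proof.
move=> mA; apply/esym/lebesgue_measure_unique => //= [|_ _ [[a b]] _ <-].
  exact: measurable_funD.
rewrite /pushforward.
have -> : (fun x => x + c : measurableTypeR R) @^-1` `]a, b] = `]a - c, b - c].
  by apply/seteqP; split => x /=; rewrite !in_itv/= ltrBlDr lerBrDr.
rewrite !lebesgue_measure_itv/= !lte_fin ltrD2r.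
by rewrite -!EFinB opprB addrA subrK.
Qed.

(** The image of mu is compared with nu on measurable sets only: uniqueness
    theorems for measures give no more. *)
Lemma Rintegral_measure_preserving (R : realType) dX dY (X : measurableType dX)
    (Y : measurableType dY) (mu : {measure set X -> \bar R})
    (nu : {measure set Y -> \bar R})
    (phi : X -> Y) (D : set Y) (f : Y -> R) :
  measurable_fun setT phi ->
  (forall A, measurable A -> pushforward mu phi A = nu A) ->
  measurable D -> measurable_fun setT f ->
  mu.-integrable (phi @^-1` D) (EFin \o f \o phi) ->
  \int[nu]_(y in D) f y = \int[mu]_(x in phi @^-1` D) f (phi x).
Proof.
move=> mphi phiE mD mf intf; congr fine.
transitivity (\int[pushforward mu phi]_(y in D) (f y)%:E)%E.
  by apply: eq_measure_integral => /= A mA _; exact/esym/phiE.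
by rewrite (@integral_pushforward _ _ _ _ _ _ mphi mu D (EFin \o f)) //;
  exact/measurable_EFinP.
Qed.

Lemma integrable_measure_preserving (R : realType) dX dY (X : measurableType dX)
    (Y : measurableType dY) (mu : {measure set X -> \bar R})
    (nu : {measure set Y -> \bar R})
    (phi : X -> Y) (D : set Y) (f : Y -> R) :
  measurable_fun setT phi ->
  (forall A, measurable A -> pushforward mu phi A = nu A) ->
  measurable D -> measurable_fun setT f ->
  mu.-integrable (phi @^-1` D) (EFin \o f \o phi) ->
  nu.-integrable D (EFin \o f).
Proof.
move=> mphi phiE mD mf intf.
have mEf : measurable_fun setT (EFin \o f) by exact/measurable_EFinP.
have /integrableP[_] := @integrable_pushforward _ _ _ _ _ _ mphi mu D _ mEf intf mD.
move=> foo; apply/integrableP; split; first exact: measurable_funTS.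
apply: le_lt_trans foo; rewrite le_eqVlt; apply/orP; left; apply/eqP.
by apply: eq_measure_integral => /= A mA _; exact/esym/phiE.
Qed.

Definition shear {R : realType} (z : R * R) : R * R := (z.1, z.1 + z.2).

Lemma measurable_shear (R : realType) : measurable_fun setT (@shear R).
Proof.
apply/measurable_fun_pair => //; exact: measurable_funD.
Qed.

(** The slices of the preimage are translates of the slices of A. *)
Lemma lebesgue_measure_shear (R : realType) (A : set (R * R)) :
  measurable A ->
  pushforward (@lebesgue_measure R \x @lebesgue_measure R)%E shear A
    = (@lebesgue_measure R \x @lebesgue_measure R)%E A.
Proof.
move=> mA; rewrite /pushforward /product_measure1/=.
apply: eq_integral => x _ /=.
rewrite -[RHS](@lebesgue_measure_shift _ x); last exact: measurable_xsection.
congr lebesgue_measure; apply/seteqP; split => y;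
  by rewrite /xsection/= !inE/= /shear/= addrC.
Qed.

(** * Derivatives along translations and of moving integrals *)
Lemma growth_rate_translate (R : realType) (V : normedModType R) (f : R -> V)
    (c t v : R) :
  (fun h => h^-1 *: (((fun s => f (s + c)) \o shift t) (h *: v) - f (t + c))) =
  (fun h => h^-1 *: ((f \o shift (t + c)) (h *: v) - f (t + c))).
Proof. by apply/funext => h /=; rewrite addrA. Qed.

Lemma derive_translate (R : realType) (V : normedModType R) (f : R -> V)
    (c t v : R) : 'D_v (fun s => f (s + c)) t = 'D_v f (t + c).
Proof. by rewrite /derive growth_rate_translate. Qed.

Lemma is_derive_translate (R : realType) (V : normedModType R) (f : R -> V)
    (c t v : R) (df : V) :
  is_derive (t + c) v f df -> is_derive t v (fun s => f (s + c)) df.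
Proof.
move=> [fd <-]; apply: DeriveDef; last exact: derive_translate.
by rewrite /derivable growth_rate_translate.
Qed.

Lemma is_derive_continuous (R : realType) (f : R -> R) (x df : R) :
  is_derive x 1 f df -> {for x, continuous f}.
Proof.
by move=> [fd _]; apply: differentiable_continuous; exact/derivable1_diffP.
Qed.

Lemma is_derive_derive1 (R : realType) (V : normedModType R) (f : R -> V) (x : R) :
  derivable f x 1 -> is_derive x 1 f (derive1 f x).
Proof. by move=> fx; rewrite derive1E; exact: derivableP. Qed.

Lemma derivable1_continuous (R : realType) (V : normedModType R) (f : R -> V) :
  (forall x, derivable f x 1) -> continuous f.
Proof.
by move=> df x; apply: differentiable_continuous; exact/derivable1_diffP.
Qed.

Lemma continuous_translate (R : realType) (f : R -> R) (s : R) :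
  continuous f -> continuous (fun x => f (x + s)).
Proof.
move=> cf x; apply: (@continuous_comp _ _ _ (fun x => x + s) f); last exact: cf.
by apply: continuousD; [exact: cvg_id | exact: cvg_cst].
Qed.

Lemma continuous_segment_integrable (R : realType) (f : R -> R) (a b : R) :
  continuous f ->
  (@lebesgue_measure R).-integrable `[a, b]%classic (EFin \o f).
Proof.
move=> cf; apply: continuous_compact_integrable; first exact: segment_compact.
exact: continuous_subspaceT.
Qed.

(** The integral is the difference of a primitive at s and at s - r. *)
Lemma is_derive_window (R : realType) (f : R -> R) (r t : R) :
  continuous f -> 0 < r ->
  is_derive t 1 (fun s => \int[@lebesgue_measure R]_(x in `]- r, 0[) f (x + s))
    (f t - f (t - r)).
Proof.
move=> cf r0.
(* The primitive starts left of s - r for all s with |s - t| < 1, so the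
   identity with its increments holds near t only. *)
pose a := t - r - 2.
pose F y := \int[@lebesgue_measure R]_(x in `[a, y]) f x.
have dF y : a < y -> is_derive y 1 F (f y).
  move=> ay.
  have [||dF dF1] := @continuous_FTC1_closed R f a y (y + 1) _ _ ay (cf y).
  - by rewrite ltrDl.
  - exact: continuous_segment_integrable.
  - by apply: DeriveDef => //; rewrite -derive1E.
have cfs s := @continuous_translate R f s cf.
apply: (@near_eq_is_derive _ _ _ (fun s => F s - F (s - r))).
  near=> s.
  have ts : t - 1 < s by near: s; apply: lt_nbhsr; rewrite ltrBlDr ltrDl.
  have si b c : (@lebesgue_measure R).-integrable
      [set` Interval (BSide b (- r)) (BSide c 0)] (EFin \o (fun x => f (x + s))).
    apply: (integrableS _ _ _ (continuous_segment_integrable (- r) 0 (cfs s))) => //.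
    by move=> x /=; rewrite !in_itv/= => /andP[/lteifW -> /lteifW ->].
  rewrite Rintegral_itv_bndo_bndc// Rintegral_itv_obnd_cbnd//.
  apply: EFin_inj.
  rewrite fineK; last first.
    by apply: integrable_fin_num => //; exact: (si true false).
  have dFs x : - r <= x -> is_derive x 1 (fun x => F (x + s)) (f (x + s)).
    by move=> rx; apply: is_derive_translate; apply: dF; rewrite /a; lra.
  rewrite (@continuous_FTC2 R (fun x => f (x + s)) (fun x => F (x + s))).
  - by rewrite add0r [- r + s]addrC.
  - by lra.
  - exact: continuous_subspaceT.
  - split.
    + by move=> x; rewrite in_itv/= => /andP[/ltW/dFs rx _]; exact: ex_derive.
    + apply: cvg_at_right_filter; apply: (is_derive_continuous (dFs _ _)).
      exact: lexx.
    + apply: cvg_at_left_filter; apply: (is_derive_continuous (dFs _ _)); lra.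
  - move=> x; rewrite in_itv/= => /andP[/ltW/dFs rx _].
    by rewrite derive1E; exact: derive_val.
apply: is_deriveB; first by apply: dF; rewrite /a; lra.
by apply: is_derive_translate; apply: dF; rewrite /a; lra.
Unshelve. all: by end_near. Qed.

Lemma integrable_mul_bounded (R : realType) (k w : R -> R) (C : R) :
  (@lebesgue_measure R).-integrable setT (EFin \o k) ->
  measurable_fun setT w -> (forall x, `|w x| <= C) ->
  (@lebesgue_measure R).-integrable setT (fun x => (k x * w x)%:E).
Proof.
move=> ki mw wC.
rewrite (_ : (fun _ => _) = (EFin \o k) \* (EFin \o w))%E//.
apply: integrableMl => //.
exists C; split; first exact: num_real.
by move=> M CM x _ /=; rewrite (le_trans (wC x))// ltW.
Qed.

(** The bound is uniform over all x, so any neighbourhood of a may serve as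
    the domain where the difference quotients are dominated. *)
Lemma is_derive_under_integral (R : realType) (d : measure_display)
    (Y : measurableType d) (mu : {measure set Y -> \bar R})
    (f df : R -> Y -> R) (B : set Y) (a : R) (G : Y -> R) :
  measurable B ->
  (forall x, mu.-integrable B (EFin \o f x)) ->
  (forall (x : R) y, B y -> is_derive x 1 (f ^~ y) (df x y)) ->
  (forall y, 0 <= G y) ->
  mu.-integrable B (EFin \o G) ->
  (forall x y, B y -> `|df x y| <= G y) ->
  is_derive a 1 (fun x => \int[mu]_(y in B) f x y) (\int[mu]_(y in B) df a y).
Proof.
move=> mB intf dfP G0 iG dfG.
have d1E x y : B y -> partial1of2 f x y = df x y.
  by move=> By; rewrite partial1of2E; have [_ ->] := dfP x y By.
have aI : `](a - 1), (a + 1)[%classic a.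
  by rewrite /= in_itv/= ltrDl ltr01 andbT ltrBlDr ltrDl.
have derf x y : `](a - 1), (a + 1)[%classic x -> B y -> derivable (f ^~ y) x 1.
  by move=> _ By; have [] := dfP x y By.
have Gub x y : `](a - 1), (a + 1)[%classic x -> B y ->
    `|partial1of2 f x y| <= G y.
  by move=> _ By; rewrite d1E//; exact: dfG.
apply: DeriveDef.
  refine (derivable_under_integral mB aI (fun x _ => intf x) derf G0 iG Gub).
rewrite -derive1E.
rewrite (differentiation_under_integral mB aI (fun x _ => intf x) derf G0 iG Gub).
by apply: eq_Rintegral => y; rewrite inE => By; rewrite d1E.
Qed.

(** * Convolution with an even kernel *)

(** For an even kernel this is the convolution k * f, in the form in which the
    kernel does not depend on t, so that derivatives in t fall on f. *)
Definition correlation {R : realType} (k f : R -> R) (t : R) : R :=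
  \int[@lebesgue_measure R]_r (k r * f (t + r)).

Lemma integrable_correlation (R : realType) (k f : R -> R) (C t : R) :
  (@lebesgue_measure R).-integrable setT (EFin \o k) ->
  continuous f -> (forall x, `|f x| <= C) ->
  (@lebesgue_measure R).-integrable setT (fun r => (k r * f (t + r))%:E).
Proof.
move=> ki cf fC; apply: (integrable_mul_bounded (C := C)) => //.
apply: continuous_measurable_fun.
by under eq_fun do rewrite addrC; exact: continuous_translate.
Qed.

Lemma is_derive_correlation (R : realType) (k f df : R -> R) (C C' t : R) :
  (@lebesgue_measure R).-integrable setT (EFin \o k) ->
  (forall x : R, is_derive x 1 f (df x)) ->
  (forall x, `|f x| <= C) -> (forall x, `|df x| <= C') ->
  is_derive t 1 (correlation k f) (correlation k df t).
Proof.
move=> ki fdf fC dfC.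
have cf : continuous f by move=> x; exact: is_derive_continuous (fdf x).
have C'0 : 0 <= C' by exact: le_trans (normr_ge0 _) (dfC 0).
apply: (@is_derive_under_integral _ _ _ (@lebesgue_measure R)
  (fun t r => k r * f (t + r)) (fun t r => k r * df (t + r)) setT t
  (fun r => C' * `|k r|)) => //.
- by move=> x; apply: integrable_correlation fC.
- move=> x y _; apply: (@is_deriveZ _ _ _ (fun s => f (s + y)) (k y)).
  exact: is_derive_translate.
- by move=> y; rewrite mulr_ge0.
- rewrite (_ : EFin \o _ = fun r => C'%:E * (EFin \o (Num.Def.normr \o k)) r)%E//.
  by apply: integrableZl => //; exact: integrable_norm.
- by move=> x y _; rewrite normrM mulrC ler_wpM2r.
Qed.

(** * The double integral over the sheared quadrant *)
Definition quadrant {R : realType} : set (R * R) :=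
  `]-oo, 0[%classic `*` `]0, +oo[%classic.

Lemma measurable_quadrant (R : realType) : measurable (@quadrant R).
Proof. by apply: measurableX; exact: measurable_itv. Qed.

Lemma measurable_strip (R : realType) : measurable (shear @^-1` @quadrant R).
Proof.
rewrite -[X in measurable X]setTI.
by apply: measurable_shear => //; exact: measurable_quadrant.
Qed.

(** Over r > 0 the sheared quadrant is an interval of length r, and over
    r <= 0 it is empty: this is where the first moment of the kernel enters. *)
Lemma strip_section (R : realType) (x r : R) :
  (shear @^-1` quadrant) (x, r) <-> `]- r, 0[%classic x.
Proof.
by rewrite /quadrant/shear/= !in_itv/= andbT; split=> [[? ?]|/andP[? ?]];
  [apply/andP|]; split=> //; lra.
Qed.

Section StripIntegral.
Variables (R : realType) (k : R -> R) (w : R * R -> R) (C : R).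
Hypothesis mk : measurable_fun setT k.
Hypothesis k1 : (@lebesgue_measure R).-integrable setT (fun r => (r * k r)%:E).
Hypothesis mw : measurable_fun setT w.
Hypothesis wC : forall z, `|w z| <= C.
Hypothesis cw : forall r, continuous (fun x => w (x, r)).

Let F (z : R * R) : R := k z.2 * w z.

Let mF : measurable_fun setT F.
Proof. by apply: measurable_funM => //; exact: measurableT_comp. Qed.

Let FD : R * R -> \bar R := (EFin \o F) \_ (shear @^-1` quadrant).

Let mFD : measurable_fun setT FD.
Proof.
apply/(measurable_restrictT _ (@measurable_strip R)).
by apply: measurable_funTS; exact/measurable_EFinP.
Qed.

Let FD_section (r : R) :
  (fun x => FD (x, r)) = (fun x => (F (x, r))%:E) \_ (`]- r, 0[%classic).
Proof.
apply/funext => x; rewrite /FD /patch; congr (if _ then _ else _).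
by apply/idP/idP => /set_mem/strip_section/mem_set.
Qed.

Let inner_integrable (r : R) : (@lebesgue_measure R).-integrable
  `]- r, 0[%classic (EFin \o (fun x => w (x, r))).
Proof.
have := @continuous_segment_integrable R _ (- r) 0 (@cw r).
apply: integrableS => //.
exact: subset_itv_oo_cc.
Qed.

Let FD_inner (r : R) : (\int[@lebesgue_measure R]_x FD (x, r))%E =
  (k r * \int[@lebesgue_measure R]_(x in `]- r, 0[) w (x, r))%:E.
Proof.
rewrite FD_section -integral_mkcond -RintegralZl//.
rewrite fineK//; apply: integrable_fin_num => //.
rewrite (_ : (fun x => _) = fun x => (k r)%:E * (EFin \o (fun x => w (x, r))) x)%E//.
exact: integrableZl.
Qed.

Let mFD_inner : measurable_fun setT
  (fubini_G (@lebesgue_measure R) (abse \o FD)).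
Proof.
have mabs : measurable_fun setT (abse \o FD) by exact: measurableT_comp.
exact: (@measurable_fun_fubini_tonelli_G _ _ _ (measurableTypeR R) _
  (@lebesgue_measure R) (abse \o FD) mabs (fun=> abse_ge0 _)).
Qed.

(** Integrating first in x, the slice over r contributes at most C |r k(r)|. *)
Lemma integrable_strip :
  (@lebesgue_measure R \x @lebesgue_measure R)%E.-integrable
    (shear @^-1` quadrant) (EFin \o F).
Proof.
apply/integrable_mkcond; first exact: measurable_strip.
apply/integrable21ltyP => //.
have C0 : 0 <= C by exact: le_trans (normr_ge0 _) (wC (0, 0)).
have kC : (@lebesgue_measure R).-integrable setT (fun r => C%:E * (r * k r)%:E)%E.
  exact: integrableZl.
have /integrableP[mkC] := kC.
apply: le_lt_trans; apply: ge0_le_integral => //.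
- by move=> r _; exact: integral_ge0.
- exact: measurableT_comp.
move=> r _.
have -> : (fun x => `|FD (x, r)|)%E =
    (fun x => `|F (x, r)|%:E) \_ (`]- r, 0[%classic).
  apply/funext => x; move: (FD_section r) => /(congr1 (@^~ x))/= ->.
  by rewrite /patch; case: ifPn => // _; rewrite abse0.
rewrite -integral_mkcond.
have FC : (\int[@lebesgue_measure R]_(x in `](- r)%R, 0%R[) `|F (x, r)|%:E <=
    \int[@lebesgue_measure R]_(x in `](- r)%R, 0%R[) cst (C * `|k r|)%:E x)%E.
  apply: ge0_le_integral => //.
  - apply/measurable_EFinP.
    rewrite (_ : (fun x => _) = Num.Def.normr \o (fun x => F (x, r)))//.
    apply: measurableT_comp => //.
    apply: (@measurable_funM _ _ _ _ (cst (k r)) (fun x => w (x, r))) => //.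
    by have /integrableP[/measurable_EFinP] := inner_integrable r.
  - by move=> x _; rewrite lee_fin /F normrM mulrC ler_wpM2r.
apply: (le_trans FC).
rewrite integral_cst//= lebesgue_measure_itv/= lte_fin oppr_lt0.
case: ifPn => r0; last by rewrite mule0.
rewrite add0e opprK -EFinM lee_fin !normrM (ger0_norm C0) gtr0_norm//.
by rewrite [r * _]mulrC mulrA.
Qed.

Let integrable_FD :
  (@lebesgue_measure R \x @lebesgue_measure R)%E.-integrable setT FD.
Proof.
apply: (iffLR (integrable_mkcond _ _)); last exact: integrable_strip.
exact: measurable_strip.
Qed.

Lemma integrable_strip_inner : (@lebesgue_measure R).-integrable setT
  (fun r => (k r * \int[@lebesgue_measure R]_(x in `]- r, 0[) w (x, r))%:E).
Proof.
rewrite (_ : (fun r => _) = fubini_G (@lebesgue_measure R) FD); last first.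
  by apply/funext => r; rewrite /fubini_G FD_inner.
have /integrable21ltyP iFD := integrable_FD.
apply/integrableP; split; first exact: measurable_fubini_G integrable_FD.
apply: le_lt_trans (iFD mFD); apply: ge0_le_integral => //.
- by apply: measurableT_comp => //; exact: measurable_fubini_G integrable_FD.
move=> r _; apply: le_abse_integral => //.
exact: (measurable_fun_pair1 (f := FD)).
Qed.

Lemma Rintegral_strip :
  \int[(@lebesgue_measure R \x @lebesgue_measure R)%E]_(z in shear @^-1` quadrant)
    (k z.2 * w z) =
  \int[@lebesgue_measure R]_(r in `]0, +oo[)
    (k r * \int[@lebesgue_measure R]_(x in `]- r, 0[) w (x, r)).
Proof.
congr fine; rewrite integral_mkcond -/FD -integral21_prod_meas1//.
rewrite [RHS]integral_mkcond; apply: eq_integral => r _.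
rewrite /fubini_G FD_inner /patch; case: ifPn => //.
rewrite notin_setE/= in_itv/= andbT => /negP; rewrite -leNgt => r0.
rewrite set_itv_ge ?bnd_simp -?leNgt ?oppr_ge0//.
by rewrite Rintegral_set0 mulr0.
Qed.

End StripIntegral.

(** * The derivative of the double integral *)
Lemma Rintegral_fold (R : realType) (q : R -> R) :
  (@lebesgue_measure R).-integrable setT (EFin \o q) ->
  \int[@lebesgue_measure R]_x q x =
  \int[@lebesgue_measure R]_(x in `]0, +oo[) (q x + q (- x)).
Proof.
move=> qi.
have oppD : -%R @^-1` `]-oo, 0[%classic = `]0, +oo[%classic :> set R.
  by apply/seteqP; split=> x /=; rewrite !in_itv/= andbT oppr_lt0.
have mq : measurable_fun setT q by have /integrableP[/measurable_EFinP] := qi.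
have qiD (D : set R) : measurable D -> (@lebesgue_measure R).-integrable D (EFin \o q).
  by move=> mD; exact: integrableS qi.
have qNi : (@lebesgue_measure R).-integrable `]0, +oo[%classic
    (EFin \o (fun x => q (- x))).
  apply/integrableP; split.
    apply: measurable_funTS; apply/measurable_EFinP.
    exact: measurableT_comp.
  have /integrableP[_] := qiD `]-oo, 0[%classic (measurable_itv _).
  have -> : (\int[@lebesgue_measure R]_(x in `]-oo, 0%R[) `|(EFin \o q) x| =
      \int[pushforward (@lebesgue_measure R) (-%R : _ -> measurableTypeR R)]_(x in
         `]-oo, 0%R[) `|(EFin \o q) x|)%E.
    by apply: eq_measure_integral => //= A mA _; exact/esym/lebesgue_measureN.
  rewrite ge0_integral_pushforward//.
    by rewrite oppD.
  apply: measurable_funTS; apply: measurableT_comp => //.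
  exact/measurable_EFinP.
have -> : [set: R] = `]-oo, 0[%classic `|` `[0, +oo[%classic.
  apply/seteqP; split=> // x _ /=; rewrite !in_itv/= andbT.
  by case: (ltP x 0); [left|right].
rewrite Rintegral_setU//; last 2 first.
- by apply: qiD; exact: measurableU.
- apply/disj_set2P; apply/seteqP; split=> // x [] /=; rewrite !in_itv/= andbT.
  by move=> /lt_le_trans/[apply]; rewrite ltxx.
rewrite -Rintegral_itv_obnd_cbnd; last by apply: qiD; exact: measurable_itv.
rewrite RintegralD//; last by apply: qiD; exact: measurable_itv.
rewrite addrC; congr +%R.
rewrite (@Rintegral_measure_preserving R _ _ (measurableTypeR R) (measurableTypeR R)
  (@lebesgue_measure R) (@lebesgue_measure R) -%R) //.
- by rewrite oppD.
- exact: lebesgue_measureN.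
- by rewrite oppD.
Qed.

(** The double integral for one entry k of the kernel and one pair of
    components, evaluated on the shift by t; h stands for the derivative of a
    component. *)
Definition crossing {R : realType} (k f h : R -> R) (t : R) : R :=
  \int[(@lebesgue_measure R \x @lebesgue_measure R)%E]_(z in quadrant)
    (k (z.1 - z.2) * (f (z.1 + t) * h (z.2 + t) - f (z.2 + t) * h (z.1 + t))).

Section Crossing.
Variables (R : realType) (k f h : R -> R) (C : R).
Hypothesis ki : (@lebesgue_measure R).-integrable setT (EFin \o k).
Hypothesis k1 : (@lebesgue_measure R).-integrable setT (fun r => (r * k r)%:E).
Hypothesis kN : forall r, k (- r) = k r.
Hypotheses (cf : continuous f) (ch : continuous h).
Hypotheses (fC : forall x, `|f x| <= C) (hC : forall x, `|h x| <= C).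

(** The kernel-free part of the integrand at (x, x + r). *)
Let psi (r x : R) : R := f x * h (x + r) - f (x + r) * h x.

Let cpsi r : continuous (psi r).
Proof.
move=> x; have cfr := @continuous_translate R f r cf.
have chr := @continuous_translate R h r ch.
by apply: cvgB; apply: cvgM; [exact: cf|exact: chr|exact: cfr|exact: ch].
Qed.

Let psiC r x : `|psi r x| <= C * C + C * C.
Proof.
by rewrite (le_trans (ler_normB _ _))// !normrM lerD// ler_pM.
Qed.

Let mk : measurable_fun setT k.
Proof. by have /integrableP[/measurable_EFinP] := ki. Qed.

Let mf : measurable_fun setT f. Proof. exact: continuous_measurable_fun. Qed.
Let mh : measurable_fun setT h. Proof. exact: continuous_measurable_fun. Qed.

Let mpsi t : measurable_fun setT (fun z : R * R => psi z.2 (z.1 + t)).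
Proof.
have m1 : measurable_fun setT (fun z : R * R => z.1 + t) by exact: measurable_funD.
have m2 : measurable_fun setT (fun z : R * R => z.1 + t + z.2).
  by apply: measurable_funD.
by apply: measurable_funB; apply: measurable_funM;
  first [exact: (measurableT_comp mf m1)|exact: (measurableT_comp mf m2)
        |exact: (measurableT_comp mh m1)|exact: (measurableT_comp mh m2)].
Qed.

Let cpsit t r : continuous (fun x => psi r (x + t)).
Proof. exact: continuous_translate. Qed.

Let psitC t (z : R * R) : `|psi z.2 (z.1 + t)| <= C * C + C * C.
Proof. exact: psiC. Qed.

Let I t (z : R * R) : R :=
  k (z.1 - z.2) * (f (z.1 + t) * h (z.2 + t) - f (z.2 + t) * h (z.1 + t)).

Let I_shear t z : I t (shear z) = k z.2 * psi z.2 (z.1 + t).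
Proof.
by rewrite /I /shear /psi/= opprD addNKr kN [z.1 + z.2 + t]addrAC.
Qed.

Let mI t : measurable_fun setT (I t).
Proof.
have m1 : measurable_fun setT (fun z : R * R => z.1 + t) by exact: measurable_funD.
have m2 : measurable_fun setT (fun z : R * R => z.2 + t) by exact: measurable_funD.
apply: measurable_funM.
  by apply: (measurableT_comp mk); exact: measurable_funB.
by apply: measurable_funB; apply: measurable_funM;
  first [exact: (measurableT_comp mf m1)|exact: (measurableT_comp mf m2)
        |exact: (measurableT_comp mh m1)|exact: (measurableT_comp mh m2)].
Qed.

Let iI t : (@lebesgue_measure R \x @lebesgue_measure R)%E.-integrable
  (shear @^-1` quadrant) (EFin \o I t \o shear).
Proof.
have := integrable_strip mk k1 (@mpsi t) (@psitC t) (@cpsit t).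
by apply: eq_integrable => [|z _]; [exact: measurable_strip|rewrite /= I_shear].
Qed.

Lemma integrable_crossing t :
  (@lebesgue_measure R \x @lebesgue_measure R)%E.-integrable quadrant
    (EFin \o (fun z => k (z.1 - z.2) *
      (f (z.1 + t) * h (z.2 + t) - f (z.2 + t) * h (z.1 + t)))).
Proof.
apply: (@integrable_measure_preserving R _ _
  (measurableTypeR R * measurableTypeR R)%type
  (measurableTypeR R * measurableTypeR R)%type
  (@lebesgue_measure R \x @lebesgue_measure R)%E
  (@lebesgue_measure R \x @lebesgue_measure R)%E (@shear R)).
- exact: measurable_shear.
- exact: lebesgue_measure_shear.
- exact: measurable_quadrant.
- exact: mI.
- exact: iI.
Qed.

Lemma crossing_strip t : crossing k f h t =
  \int[@lebesgue_measure R]_(r in `]0, +oo[)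
    (k r * \int[@lebesgue_measure R]_(x in `]- r, 0[) psi r (x + t)).
Proof.
rewrite /crossing (@Rintegral_measure_preserving R _ _
  (measurableTypeR R * measurableTypeR R)%type
  (measurableTypeR R * measurableTypeR R)%type
  (@lebesgue_measure R \x @lebesgue_measure R)%E
  (@lebesgue_measure R \x @lebesgue_measure R)%E (@shear R)).
- rewrite -(Rintegral_strip mk k1 (@mpsi t) (@psitC t) (@cpsit t)).
  by apply: eq_Rintegral => z _; exact: I_shear.
- exact: measurable_shear.
- exact: lebesgue_measure_shear.
- exact: measurable_quadrant.
- exact: mI.
- exact: iI.
Qed.

(** By [is_derive_window] the derivative is the integral over r > 0 of
    k(r) (psi r t - psi r (t - r)); the two terms are the values at r and - r
    of one function, because k is even. *)
Lemma is_derive_crossing (t : R) :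
  is_derive t 1 (crossing k f h)
    (f t * correlation k h t - h t * correlation k f t).
Proof.
rewrite (_ : crossing k f h = fun t => \int[@lebesgue_measure R]_(r in `]0, +oo[)
    (k r * \int[@lebesgue_measure R]_(x in `]- r, 0[) psi r (x + t))); last first.
  by apply/funext => s; exact: crossing_strip.
have icorr g : continuous g -> (forall x, `|g x| <= C) ->
    (@lebesgue_measure R).-integrable setT (fun r => (k r * g (t + r))%:E).
  by move=> cg gC; exact: integrable_correlation gC.
have icorrZ c g : continuous g -> (forall x, `|g x| <= C) ->
    (@lebesgue_measure R).-integrable setT
      (EFin \o (fun r => c * (k r * g (t + r)))).
  move=> cg gC; rewrite (_ : EFin \o _ =
    fun r => c%:E * (k r * g (t + r))%:E)%E//.
  by apply: integrableZl => //; exact: icorr.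
pose q r := f t * (k r * h (t + r)) - h t * (k r * f (t + r)).
have qi : (@lebesgue_measure R).-integrable setT (EFin \o q).
  rewrite (_ : EFin \o q = (EFin \o (fun r => f t * (k r * h (t + r)))%R) \-
      (EFin \o (fun r => h t * (k r * f (t + r)))%R))%E//.
  by apply: integrableB => //; exact: icorrZ.
have qE : \int[@lebesgue_measure R]_r q r =
    f t * correlation k h t - h t * correlation k f t.
  rewrite RintegralB//; [|exact: icorrZ..].
  by rewrite !RintegralZl//; exact: icorr.
rewrite -qE Rintegral_fold//.
rewrite [X in is_derive _ _ _ X](_ : _ =
    \int[@lebesgue_measure R]_(r in `]0, +oo[)
      (k r * (psi r t - psi r (t - r)))); last first.
  apply: eq_Rintegral => r _; rewrite /q /psi kN subrK; ring.
apply: (@is_derive_under_integral R _ (measurableTypeR R) (@lebesgue_measure R)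
  (fun t r => k r * \int[@lebesgue_measure R]_(x in `]- r, 0[) psi r (x + t))
  (fun t r => k r * (psi r t - psi r (t - r)))
  `]0, +oo[%classic t (fun r => (C * C + C * C + (C * C + C * C)) * `|k r|)) => //.
- move=> s; apply: (integrableS measurableT) => //.
  exact: (integrable_strip_inner mk k1 (@mpsi s) (@psitC s) (@cpsit s)).
- move=> s r /=; rewrite in_itv/= andbT => r0.
  apply: (@is_deriveZ _ _ _
    (fun s => \int[@lebesgue_measure R]_(x in `]- r, 0[) psi r (x + s)) (k r)).
  exact: is_derive_window.
- by move=> r; rewrite mulr_ge0// !addr_ge0// mulr_ge0// (le_trans _ (fC 0)).
- apply: (integrableS measurableT) => //.
  rewrite (_ : EFin \o _ = fun r => (C * C + C * C + (C * C + C * C))%:E *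
     (EFin \o (Num.Def.normr \o k)) r)%E//.
  by apply: integrableZl => //; exact: integrable_norm.
- move=> s r _; rewrite normrM mulrC ler_wpM2r//.
  by rewrite (le_trans (ler_normB _ _))// lerD.
Qed.

End Crossing.

(** * Gradients, Jacobians and the local part of the Hamiltonian *)
Lemma cV_sum_delta (R : realType) d (w : 'cV[R]_d) :
  w = \sum_j w j 0 *: delta_mx j 0.
Proof.
by rewrite [w in LHS]matrix_sum_delta; apply: eq_bigr => j _; rewrite big_ord1.
Qed.

Lemma is_derive_coord (R : realType) (V : normedModType R) m n
    (M : V -> 'M[R]_(m, n)) (t v : V) dM i j :
  is_derive t v M dM -> is_derive t v (fun s => M s i j) (dM i j).
Proof.
move=> [dMt <-]; apply: DeriveDef; first by move/derivable_mxP: dMt; apply.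
by rewrite derive_mx// mxE.
Qed.

Lemma is_derive_comp_diff (R : realType) (V W : normedModType R)
    (f : V -> W) (u : R -> V) (t : R) du :
  differentiable f (u t) -> is_derive t 1 u du ->
  is_derive t 1 (fun s => f (u s)) ('d f (u t) du).
Proof.
move=> df [ud <-]; have ud' : differentiable u t by exact/derivable1_diffP.
apply: DeriveDef.
  by apply/derivable1_diffP; exact: (@differentiable_comp _ _ _ _ u f).
rewrite (@deriveE _ _ _ (f \o u)); last exact: (@differentiable_comp _ _ _ _ u f).
by rewrite diff_comp//= [in RHS]deriveE.
Qed.

Lemma dotpDl (R : realType) d (v w z : 'cV[R]_d) :
  dotp (v + w) z = dotp v z + dotp w z.
Proof.
by rewrite -big_split/=; apply: eq_bigr => i _; rewrite mxE mulrDl.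
Qed.

Lemma dotpNl (R : realType) d (v z : 'cV[R]_d) : dotp (- v) z = - dotp v z.
Proof. by rewrite -sumrN; apply: eq_bigr => i _; rewrite mxE mulNr. Qed.

Lemma dotp0l (R : realType) d (z : 'cV[R]_d) : dotp 0 z = 0.
Proof. by rewrite /dotp big1// => i _; rewrite mxE mul0r. Qed.

Lemma dotp0r (R : realType) d (z : 'cV[R]_d) : dotp z 0 = 0.
Proof. by rewrite /dotp big1// => i _; rewrite mxE mulr0. Qed.

Lemma dotp_mulmx_trmx (R : realType) d (A : 'M[R]_d) (v w : 'cV[R]_d) :
  dotp (A^T *m v) w = dotp v (A *m w).
Proof.
have dotpE (a b : 'cV[R]_d) : dotp a b = (a^T *m b) 0 0.
  by rewrite mxE; apply: eq_bigr => i _; rewrite mxE.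
by rewrite !dotpE trmx_mul trmxK mulmxA.
Qed.

Lemma is_derive_dotp (R : realType) d (v w : R -> 'cV[R]_d) (t : R) dv dw :
  is_derive t 1 v dv -> is_derive t 1 w dw ->
  is_derive t 1 (fun s => dotp (v s) (w s)) (dotp dv (w t) + dotp (v t) dw).
Proof.
move=> dvt dwt; rewrite /dotp.
rewrite (_ : (fun s => _) = \sum_(i < d) (fun s => v s i 0 * w s i 0)); last first.
  by apply/funext => s; rewrite fct_sumE.
rewrite -big_split/=; apply: is_derive_sum => i.
have vi := is_derive_coord i 0 dvt; have wi := is_derive_coord i 0 dwt.
apply: is_derive_eq (is_deriveM vi wi) _.
by rewrite /= addrC [dv i 0 * _]mulrC.
Qed.

Lemma jac_mulmx (R : realType) d (S : 'cV[R]_d -> 'cV[R]_d) (v w : 'cV[R]_d) :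
  differentiable S v -> jac S v *m w = 'd S v w.
Proof.
move=> dS; rewrite [w in RHS]cV_sum_delta linear_sum.
apply/colP => i; rewrite mxE summxE; apply: eq_bigr => j _.
by rewrite linearZ mxE mxE deriveE// mulrC.
Qed.

Lemma grad_uE (R : realType) d (E : 'cV[R]_d * 'cV[R]_d -> R) (u v : 'cV[R]_d) :
  differentiable E (u, v) -> grad_u E u v = \col_i 'd E (u, v) (delta_mx i 0, 0).
Proof.
move=> dE; apply/colP => i; rewrite !mxE -deriveE// /derive.
suff -> : (fun h : R =>
      h^-1 *: (((fun w => E (w, v)) \o shift u) (h *: delta_mx i 0) - E (u, v))) =
    (fun h => h^-1 *: ((E \o shift (u, v)) (h *: (delta_mx i 0, 0)) - E (u, v))).
  by [].
apply/funext => h /=.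
by congr (_ *: (E _ - _)); congr (_, _); rewrite /= scaler0 add0r.
Qed.

Lemma grad_vE (R : realType) d (E : 'cV[R]_d * 'cV[R]_d -> R) (u v : 'cV[R]_d) :
  differentiable E (u, v) -> grad_v E u v = \col_i 'd E (u, v) (0, delta_mx i 0).
Proof.
move=> dE; apply/colP => i; rewrite !mxE -deriveE// /derive.
suff -> : (fun h : R =>
      h^-1 *: (((fun w => E (u, w)) \o shift v) (h *: delta_mx i 0) - E (u, v))) =
    (fun h => h^-1 *: ((E \o shift (u, v)) (h *: (0, delta_mx i 0)) - E (u, v))).
  by [].
apply/funext => h /=.
by congr (_ *: (E _ - _)); congr (_, _); rewrite /= scaler0 add0r.
Qed.

Lemma diff_pair_grad (R : realType) d (E : 'cV[R]_d * 'cV[R]_d -> R)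
    (u v a b : 'cV[R]_d) :
  differentiable E (u, v) ->
  'd E (u, v) (a, b) = dotp (grad_u E u v) a + dotp (grad_v E u v) b.
Proof.
move=> dE; rewrite grad_uE// grad_vE//.
have -> : (a, b) = \sum_j (a j 0 *: (delta_mx j 0, 0)) +
    \sum_j (b j 0 *: (0, delta_mx j 0)) :> 'cV[R]_d * 'cV[R]_d.
  apply/pair_eqP; rewrite /= !(big_morph fst (id1 := 0) (op1 := +%R))//=.
  rewrite !(big_morph snd (id1 := 0) (op1 := +%R))//=.
  rewrite -!cV_sum_delta; under [X in _ + X]eq_bigr do rewrite scaler0.
  under [X in _ && (_ == X + _)]eq_bigr do rewrite scaler0.
  by rewrite !big1// addr0 add0r !eqxx.
rewrite linearD !linear_sum/=; congr (_ + _);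
  by apply: eq_bigr => j _; rewrite linearZ mxE mulrC.
Qed.

Lemma mx_entry_le_norm (R : realType) m n (M : 'M[R]_(m, n)) i j :
  `|M i j| <= `|M|.
Proof.
by rewrite [leRHS]/Num.Def.normr/= mx_normrE; exact: (le_bigmax _ _ (i, j)).
Qed.

Lemma mx_norm_le (R : realType) m n (M : 'M[R]_(m, n)) c :
  0 <= c -> (forall i j, `|M i j| <= c) -> `|M| <= c.
Proof.
by move=> c0 Mc; rewrite /Num.Def.normr/= mx_normrE bigmax_le.
Qed.

Lemma norm_trmx (R : realType) m n (M : 'M[R]_(m, n)) : `|M^T| = `|M|.
Proof.
apply/eqP; rewrite eq_le !mx_norm_le// => i j.
  have -> : M i j = M^T j i by rewrite mxE.
  exact: mx_entry_le_norm.
by rewrite mxE mx_entry_le_norm.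
Qed.

(** A bounded curve stays in a compact ball.  Compactness of balls is used
    for row vectors, hence the transpositions. *)
Lemma bounded_comp_cV (R : realType) d (W : normedModType R)
    (f : 'cV[R]_d -> W) (u : R -> 'cV[R]_d) :
  continuous f -> bounded_fun u ->
  exists2 C, 0 <= C & forall t, `|f (u t)| <= C.
Proof.
move=> cf [M [_ uM]].
have {}uM t : `|u t| <= M + 1 by apply: uM => //; rewrite ltrDl.
pose A := [set v : 'rV[R]_d | `|v| <= M + 1].
have ctr : continuous (fun v : 'rV[R]_d => v^T).
  move=> /= v s /= /(nbhs_ballP v^T) [e e0 es].
  apply/nbhs_ballP; exists e => //= w [_ vw]; apply: es; split=> // i j.
  by rewrite !mxE; exact: vw.
have cA : compact A.
  apply: bounded_closed_compact.
    exists (M + 1); split; first exact: num_real.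
    by move=> x Mx v /= /le_trans; apply; exact: ltW.
  rewrite (_ : A = (fun v : 'rV[R]_d => `|v|) @^-1` [set x | x <= M + 1])//.
  by apply: closed_comp => [v _|]; [exact: norm_continuous|exact: closed_le].
have cg : continuous (fun v : 'rV[R]_d => `|f v^T|).
  move=> v; apply: (@continuous_comp _ _ _ (fun v => f v^T) (fun w : W => `|w|)).
    by apply: continuous_comp; [exact: ctr|exact: cf].
  exact: norm_continuous.
have A0 : A !=set0 by exists (u 0)^T; rewrite /A/= norm_trmx.
have [c _ cmax] := compact_EVT_max A0 cA (continuous_subspaceT cg).
exists `|f c^T| => // t.
by rewrite -[u t]trmxK cmax// inE /A/= norm_trmx.
Qed.

Lemma class_C_differentiable (R : realType) (V W : normedModType R) k (f : V -> W)
  x : class_C k.+1 f -> differentiable f x.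
Proof. by move=> [df _]. Qed.

Lemma is_derive_pair (R : realType) (V W : normedModType R)
    (u : R -> V) (v : R -> W) (t : R) du dv :
  is_derive t 1 u du -> is_derive t 1 v dv ->
  is_derive t 1 (fun s => (u s, v s)) (du, dv).
Proof.
move=> [ud <-] [vd <-].
have udiff : differentiable u t by exact/derivable1_diffP.
have vdiff : differentiable v t by exact/derivable1_diffP.
have pd : differentiable (fun s => (u s, v s)) t by exact: differentiable_pair.
apply: DeriveDef; first exact/derivable1_diffP.
by rewrite deriveE// diff_pair// !deriveE.
Qed.

(** The terms in u'' produced by E(u,u') and by grad_v E . u' cancel. *)
Lemma is_derive_local2 (R : realType) d (E : 'cV[R]_d * 'cV[R]_d -> R)
    (u du ddu : R -> 'cV[R]_d) (t : R) :
  class_C 2 E ->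
  (forall s : R, is_derive s 1 u (du s)) ->
  (forall s : R, is_derive s 1 du (ddu s)) ->
  is_derive t 1
    (fun s => E (u s, du s) - dotp (grad_v E (u s) (du s)) (du s))
    (dotp (- derive1 (fun y => grad_v E (u y) (du y)) t + grad_u E (u t) (du t))
       (du t)).
Proof.
move=> [dE ddE] hu hdu.
have hp := is_derive_pair (hu t) (hdu t).
have hG : is_derive t 1 (fun y => grad_v E (u y) (du y))
    (derive1 (fun y => grad_v E (u y) (du y)) t).
  rewrite derive1E; apply: derivableP; apply/derivable_mxP => i j.
  rewrite (_ : (fun x => _) = fun x => 'd E (u x, du x) (0, delta_mx i 0)).
    have [dEi _] := ddE (0, delta_mx i 0).
    by have [] := is_derive_comp_diff (dEi (u t, du t)) hp.
  by apply/funext => y; rewrite grad_vE// mxE.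
have hE := is_derive_comp_diff (dE (u t, du t)) hp.
have hD := is_derive_dotp hG (hdu t).
apply: is_derive_eq (is_deriveB hE hD) _.
rewrite diff_pair_grad//.
by rewrite dotpDl dotpNl opprD addrACA subrr addr0 addrC.
Qed.

(** If grad_v E vanishes then E(u,v) = E(u,0), and the second derivative
    of u, which need not exist, never appears. *)
Lemma is_derive_local1 (R : realType) d (E : 'cV[R]_d * 'cV[R]_d -> R)
    (u du : R -> 'cV[R]_d) (t : R) :
  class_C 2 E ->
  (forall a b, grad_v E a b = 0) ->
  (forall s : R, is_derive s 1 u (du s)) ->
  is_derive t 1
    (fun s => E (u s, du s) - dotp (grad_v E (u s) (du s)) (du s))
    (dotp (- derive1 (fun y => grad_v E (u y) (du y)) t + grad_u E (u t) (du t))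
       (du t)).
Proof.
move=> [dE _] gv0 hu.
have E0 a b : E (a, b) = E (a, 0).
  have := @is_derive_0_is_cst R (fun s => E (a, s *: b)) 1 0.
  rewrite scale1r scale0r; apply => s.
  have hsb : is_derive s 1 (fun s : R => s *: b) b.
    apply: DeriveDef.
      by apply/derivable1_diffP; exact: differentiableZl.
    rewrite deriveE; last exact: differentiableZl.
    by rewrite diffZl// -deriveE// derive_id scale1r.
  have hab := is_derive_pair (is_derive_cst a s (1 : R)) hsb.
  apply: is_derive_eq (is_derive_comp_diff (dE (a, s *: b)) hab) _.
  by rewrite diff_pair_grad// gv0 dotp0r dotp0l addr0.
rewrite (_ : (fun s => _) = fun s => E (u s, 0)); last first.
  by apply/funext => s; rewrite gv0 dotp0l subr0 E0.
have h0 := is_derive_pair (hu t) (is_derive_cst (0 : 'cV[R]_d) t (1 : R)).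
apply: is_derive_eq (is_derive_comp_diff (dE (u t, 0)) h0) _.
rewrite diff_pair_grad// gv0 dotp0l addr0.
rewrite (_ : (fun y => _) = cst 0); last by apply/funext => y; rewrite gv0.
rewrite derive1_cst oppr0 add0r; congr dotp.
by rewrite /grad_u; congr grad; apply/funext => w; rewrite [RHS]E0.
Qed.

(** * Matrix-valued kernels *)
Lemma Rintegral_sum (R : realType) d (T : measurableType d)
    (mu : {measure set T -> \bar R}) (D : set T) (I : Type) (s : seq I)
    (F : I -> T -> R) :
  measurable D -> (forall i, mu.-integrable D (EFin \o F i)) ->
  \int[mu]_(x in D) (\sum_(i <- s) F i x) = \sum_(i <- s) \int[mu]_(x in D) F i x.
Proof.
move=> mD iF; elim: s => [|a s IH].
  rewrite big_nil; apply: etrans (_ : \int[mu]_(x in D) (cst 0 x) = 0).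
    by apply: eq_Rintegral => x _; rewrite big_nil.
  by rewrite /Rintegral integral0.
rewrite big_cons -IH -RintegralD//.
  by apply: eq_Rintegral => x _; rewrite big_cons.
rewrite (_ : EFin \o _ = fun x => \sum_(i <- s) (F i x)%:E)%E.
  by apply: integrable_sum => // i _; exact: iF.
by apply/funext => x /=; rewrite sumEFin.
Qed.

(** Substitute y = x + r and use k(- r) = k(r). *)
Lemma convolution_correlation (R : realType) (k f : R -> R) (C x : R) :
  (@lebesgue_measure R).-integrable setT (EFin \o k) ->
  (forall r, k (- r) = k r) -> continuous f -> (forall y, `|f y| <= C) ->
  (@lebesgue_measure R).-integrable setT (EFin \o (fun y => k (x - y) * f y)) /\
  \int[@lebesgue_measure R]_y (k (x - y) * f y) = correlation k f x.
Proof.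
move=> ki kN cf fC.
have mk : measurable_fun setT k by have /integrableP[/measurable_EFinP] := ki.
have mkf : measurable_fun setT (fun y : R => k (x - y) * f y).
  apply: measurable_funM; last exact: continuous_measurable_fun.
  by apply: (measurableT_comp mk); exact: measurable_funB.
have msh : measurable_fun setT (fun y : R => y + x) by exact: measurable_funD.
have kE r : k (x - (r + x)) * f (r + x) = k r * f (x + r).
  by rewrite opprD addrCA subrr addr0 kN [r + x]addrC.
have ikf : (@lebesgue_measure R).-integrable setT
    (EFin \o (fun y : R => k (x - y) * f y) \o (fun y : R => y + x)).
  rewrite (_ : _ \o _ = fun r => (k r * f (x + r))%:E).
    exact: integrable_correlation fC.
  by apply/funext => r /=; rewrite kE.
split.
  apply: (@integrable_measure_preserving R _ _ (measurableTypeR R) (measurableTypeR R)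
    (@lebesgue_measure R) (@lebesgue_measure R) (fun y => y + x)) => //.
  exact: lebesgue_measure_shift.
rewrite (@Rintegral_measure_preserving R _ _ (measurableTypeR R) (measurableTypeR R)
    (@lebesgue_measure R) (@lebesgue_measure R) (fun y => y + x)) => //.
  by apply: eq_Rintegral => r _; rewrite kE.
exact: lebesgue_measure_shift.
Qed.

Lemma kernel_conv_correlation (R : realType) d (K : R -> 'M[R]_d)
    (f : R -> 'cV[R]_d) (C x : R) i :
  (forall i j, (@lebesgue_measure R).-integrable setT (fun r => (K r i j)%:E)) ->
  (forall r, K (- r) = K r) ->
  (forall j, continuous (fun y => f y j 0)) -> (forall j y, `|f y j 0| <= C) ->
  kernel_conv K f x i 0 =
    \sum_j correlation (fun r => K r i j) (fun y => f y j 0) x.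
Proof.
move=> iK KN cf fC; rewrite mxE.
have conv j := @convolution_correlation R (fun r => K r i j) (fun y => f y j 0)
  C x (iK i j) (fun r => congr1 (fun M : 'M[R]_d => M i j) (KN r)) (cf j) (fC j).
transitivity (\int[@lebesgue_measure R]_y (\sum_j (K (x - y) i j * f y j 0))).
  by apply: eq_Rintegral => y _; rewrite mxE.
rewrite Rintegral_sum//; last by move=> j; have [] := conv j.
by apply: eq_bigr => j _; have [_] := conv j.
Qed.

Lemma measurable_bigmaxr (R : realType) d (T : measurableType d) (I : Type)
    (s : seq I) (F : I -> T -> R) :
  (forall i, measurable_fun setT (F i)) ->
  measurable_fun setT (fun x => \big[Num.max/0]_(i <- s) F i x).
Proof.
move=> mF; elim: s => [|a s IH].
  by under eq_fun do rewrite big_nil; exact: measurable_cst.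
by under eq_fun do rewrite big_cons; exact: measurable_maxr.
Qed.

Lemma integrable_kernel_moment (R : realType) d (K : R -> 'M[R]_d) i j :
  kernel_hyp K ->
  (@lebesgue_measure R).-integrable setT (fun r => (r * K r i j)%:E).
Proof.
move=> [_ _ iK Kfin].
have mK a b : measurable_fun setT (fun r => K r a b).
  by have /integrableP[/measurable_EFinP] := iK a b.
have mrK : measurable_fun setT (fun r : R => (r * K r i j)%:E).
  by apply/measurable_EFinP; apply: measurable_funM; [exact: measurable_id|exact: mK].
apply/integrableP; split=> //; apply: le_lt_trans Kfin; apply: ge0_le_integral => //.
- exact: (measurableT_comp (@abse_measurable R setT)).
- apply/measurable_EFinP/measurable_funM.
    by apply: measurable_funD => //; exact: normr_measurable.
  under eq_fun do rewrite /Num.Def.normr/= mx_normrE.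
  apply: measurable_bigmaxr => ab.
  by apply: measurableT_comp => //; exact: mK.
- move=> r _; rewrite lee_fin normrM ler_pM//; last exact: mx_entry_le_norm.
  by rewrite lerDr.
Qed.

(** * The nonlocal part of the Hamiltonian *)
Section Nonlocal.
Variables (R : realType) (d : nat) (K : R -> 'M[R]_d) (s ds : R -> 'cV[R]_d) (C : R).
Hypothesis hK : kernel_hyp K.
Hypothesis dsP : forall t : R, is_derive t 1 s (ds t).
Hypothesis cds : forall i, continuous (fun t => ds t i 0).
Hypothesis sC : forall i t, `|s t i 0| <= C.
Hypothesis dsC : forall i t, `|ds t i 0| <= C.

Let k i j : R -> R := fun r => K r i j.
Let si i : R -> R := fun t => s t i 0.
Let dsi i : R -> R := fun t => ds t i 0.

Let ki i j : (@lebesgue_measure R).-integrable setT (EFin \o k i j).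
Proof. by case: hK => _ _ iK _; exact: iK. Qed.

Let k1 i j : (@lebesgue_measure R).-integrable setT (fun r => (r * k i j r)%:E).
Proof. exact: integrable_kernel_moment. Qed.

Let kN i j r : k i j (- r) = k i j r.
Proof. by case: hK => KN _ _ _; rewrite /k KN. Qed.

Let ksym i j : k i j = k j i.
Proof. by case: hK => _ KT _ _; apply/funext => r; rewrite /k -[in LHS]KT mxE. Qed.

Let siP i (t : R) : is_derive t 1 (si i) (dsi i t).
Proof. exact: is_derive_coord. Qed.

Let csi i : continuous (si i).
Proof. by move=> t; exact: is_derive_continuous (siP i t). Qed.

Lemma kernel_conv_coord t i : kernel_conv K s t i 0 =
  \sum_j correlation (k i j) (si j) t.
Proof.
by case: hK => KN _ iK _; exact: kernel_conv_correlation sC.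
Qed.

Lemma is_derive_quadratic (t : R) :
  is_derive t 1 (fun x => dotp (s x) (kernel_conv K s x))
    (\sum_i \sum_j (dsi i t * correlation (k i j) (si j) t
                    + si i t * correlation (k i j) (dsi j) t)).
Proof.
rewrite (_ : (fun x => _) = \sum_i \sum_j
    (fun x => si i x * correlation (k i j) (si j) x)); last first.
  apply/funext => x; rewrite fct_sumE; apply: eq_bigr => i _.
  by rewrite fct_sumE kernel_conv_coord mulr_sumr.
apply: is_derive_sum => i; apply: is_derive_sum => j.
have dc := is_derive_correlation t (ki i j) (siP j) (sC j) (dsC j).
apply: is_derive_eq (is_deriveM (siP i t) dc) _.
by rewrite /= addrC [dsi i t * _]mulrC.
Qed.

Let J t := \int[(@lebesgue_measure R \x @lebesgue_measure R)%E]_(z in quadrant)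
  (dotp (s (z.1 + t)) (K (z.1 - z.2) *m ds (z.2 + t))
   - dotp (s (z.2 + t)) (K (z.1 - z.2) *m ds (z.1 + t))).

Lemma quadrant_crossing t : J t =
  \sum_i \sum_j crossing (k i j) (si i) (dsi j) t.
Proof.
rewrite pair_bigA/= -Rintegral_sum; last 2 first.
- exact: measurable_quadrant.
- move=> p; exact: (integrable_crossing (ki p.1 p.2) (k1 p.1 p.2) (@kN p.1 p.2)
    (@csi p.1) (@cds p.2) (sC p.1) (dsC p.2)).
apply: eq_Rintegral => z _.
rewrite -(pair_bigA _ (fun i j => k i j (z.1 - z.2) *
  (si i (z.1 + t) * dsi j (z.2 + t) - si i (z.2 + t) * dsi j (z.1 + t))))/=.
rewrite /dotp -sumrB; apply: eq_bigr => i _.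
rewrite !mxE !mulr_sumr -sumrB; apply: eq_bigr => j _.
by rewrite /k /si /dsi; ring.
Qed.

(** The contributions of s.(K*s') cancel, and those of s'.(K*s) add up once
    the indices of the second sum are exchanged by the symmetry of K. *)
Lemma is_derive_nonlocal (t : R) :
  is_derive t 1 (fun x => - (2^-1 * dotp (s x) (kernel_conv K s x)) + 2^-1 * J x)
    (- dotp (kernel_conv K s t) (ds t)).
Proof.
have dJ : is_derive t 1 J (\sum_i \sum_j
    (si i t * correlation (k i j) (dsi j) t
     - dsi j t * correlation (k i j) (si i) t)).
  rewrite (_ : J = \sum_i \sum_j crossing (k i j) (si i) (dsi j)); last first.
    apply/funext => x; rewrite quadrant_crossing fct_sumE.
    by apply: eq_bigr => i _; rewrite fct_sumE.
  apply: is_derive_sum => i; apply: is_derive_sum => j.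
  exact: (is_derive_crossing (ki i j) (k1 i j) (@kN i j)
    (@csi i) (@cds j) (sC i) (dsC j)).
have dJZ := is_deriveZ 2^-1 dJ.
have dQZ := is_deriveN (is_deriveZ 2^-1 (is_derive_quadratic t)).
apply: is_derive_eq (is_deriveD dQZ dJZ) _.
have -> : dotp (kernel_conv K s t) (ds t) =
    \sum_i \sum_j dsi i t * correlation (k i j) (si j) t.
  by apply: eq_bigr => i _; rewrite kernel_conv_coord mulrC mulr_sumr.
have sumB (F G : 'I_d -> 'I_d -> R) :
    \sum_i \sum_j (F i j - G i j) = \sum_i \sum_j F i j - \sum_i \sum_j G i j.
  by rewrite -sumrB; apply: eq_bigr => i _; rewrite sumrB.
have sumD (F G : 'I_d -> 'I_d -> R) :
    \sum_i \sum_j (F i j + G i j) = \sum_i \sum_j F i j + \sum_i \sum_j G i j.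
  by rewrite -big_split; apply: eq_bigr => i _; rewrite big_split.
rewrite sumB sumD.
have -> : \sum_i \sum_j dsi j t * correlation (k i j) (si i) t =
    \sum_i \sum_j dsi i t * correlation (k i j) (si j) t.
  by rewrite exchange_big; apply: eq_bigr => i _; apply: eq_bigr => j _; rewrite ksym.
rewrite /GRing.scale/=; lra.
Qed.

End Nonlocal.

(** * Conservation along solutions *)
Lemma derive1_shift_by (R : realType) d (u : R -> 'cV[R]_d) (tau : R) :
  derive1 (shift_by tau u) = shift_by tau (derive1 u).
Proof.
by apply/funext => x; rewrite /shift_by !derive1E; exact: derive_translate.
Qed.

(** The columns of DS are continuous maps, so they are bounded on the range
    of u, as S is. *)
Lemma field_bounds (R : realType) d (S : 'cV[R]_d -> 'cV[R]_d)
    (u du : R -> 'cV[R]_d) :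
  class_C 2 S -> bounded_fun u -> bounded_fun du ->
  exists C, forall i t, `|S (u t) i 0| <= C /\ `|(jac S (u t) *m du t) i 0| <= C.
Proof.
move=> [dS ddS] ub [M [_ duM]].
have {}duM t : `|du t| <= M + 1 by apply: duM => //; rewrite ltrDl.
have cS : continuous S by move=> x; exact: differentiable_continuous.
have [C1 C10 SC1] := bounded_comp_cV cS ub.
have : forall j, exists D, forall t, `|'d S (u t) (delta_mx j 0)| <= D.
  move=> j; have [dSj _] := ddS (delta_mx j 0).
  have cSj : continuous (fun x => 'd S x (delta_mx j 0)).
    by move=> x; exact: differentiable_continuous.
  by have [D _ DP] := bounded_comp_cV cSj ub; exists D.
move=> /choice[D DP].
exists (C1 + \sum_j D j * (M + 1)) => i t.
have D0 j : 0 <= D j * (M + 1).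
  have Dj0 := le_trans (normr_ge0 _) (DP j 0).
  exact: mulr_ge0 Dj0 (le_trans (normr_ge0 _) (duM 0)).
have DS0 : 0 <= \sum_j D j * (M + 1) by exact: sumr_ge0.
split.
  rewrite (le_trans (mx_entry_le_norm _ _ _))// (le_trans (SC1 t))//.
  by rewrite lerDl.
rewrite mxE (le_trans (ler_norm_sum _ _ _))//.
rewrite (le_trans _ (_ : \sum_j D j * (M + 1) <= _))//.
  apply: ler_sum => j _; rewrite normrM ler_pM//.
    rewrite mxE deriveE// (le_trans _ (DP j t))//.
    exact: mx_entry_le_norm.
  by rewrite (le_trans _ (duM t))//; exact: mx_entry_le_norm.
by rewrite lerDr.
Qed.

Lemma field_velocity_continuous (R : realType) d (S : 'cV[R]_d -> 'cV[R]_d)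
    (u du : R -> 'cV[R]_d) i :
  class_C 2 S -> continuous u -> continuous du ->
  continuous (fun t => (jac S (u t) *m du t) i 0).
Proof.
move=> [dS ddS] cu cdu.
rewrite (_ : (fun t => _) = fun t =>
    \sum_j ('d S (u t) (delta_mx j 0)) i 0 * du t j 0); last first.
  apply/funext => t; rewrite mxE; apply: eq_bigr => j _.
  by rewrite mxE deriveE.
apply: continuous_big => [|j _ t]; first exact: add_continuous.
apply: cvgM.
  have [dSj _] := ddS (delta_mx j 0).
  apply: (@continuous_comp _ _ _ (fun t => 'd S (u t) (delta_mx j 0))
    (fun M : 'cV[R]_d => M i 0)); last exact: coord_continuous.
  apply: (@continuous_comp _ _ _ u (fun x => 'd S x (delta_mx j 0))).
    exact: cu.
  exact: differentiable_continuous.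
apply: (@continuous_comp _ _ _ du (fun M : 'cV[R]_d => M j 0)).
  exact: cdu.
exact: coord_continuous.
Qed.

(** In both cases of the regularity required of u it is C^1 with bounded
    derivative. *)
Lemma class_Cb1 (R : realType) d (E : 'cV[R]_d * 'cV[R]_d -> R)
    (u : R -> 'cV[R]_d) :
  class_Cb (regE E) u -> class_Cb 1 u.
Proof.
rewrite /regE; case: ifP => // _ [ud uc ub]; split.
- by move=> j x j1; apply: ud; exact: ltn_trans j1 _.
- by apply: derivable1_continuous => x; exact: (ud 1%N x).
- by move=> j j1; apply: ub; exact: leq_trans j1 _.
Qed.

Lemma is_derive_local (R : realType) d (E : 'cV[R]_d * 'cV[R]_d -> R)
    (u : R -> 'cV[R]_d) (t : R) :
  class_C 2 E -> class_Cb (regE E) u ->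
  is_derive t 1
    (fun s => E (u s, derive1 u s)
              - dotp (grad_v E (u s) (derive1 u s)) (derive1 u s))
    (dotp (- derive1 (fun y => grad_v E (u y) (derive1 u y)) t
           + grad_u E (u t) (derive1 u t)) (derive1 u t)).
Proof.
move=> hE hu.
have [ud1 _ _] := class_Cb1 hu.
have huP (s : R) : is_derive s 1 u (derive1 u s).
  exact: is_derive_derive1 (ud1 0%N s isT).
move: hu; rewrite /regE; case: asboolP => [gv0 _|_ [ud _ _]].
  exact: is_derive_local1.
have d2 (s : R) : derivable (derive1 u) s 1 := ud 1%N s isT.
exact: (is_derive_local2 t hE huP (fun s => is_derive_derive1 (d2 s))).
Qed.

(** The right-hand side groups the local and the nonlocal part, in the form
    in which each is differentiated. *)
Lemma Hamiltonian_shift (R : realType) d (E : 'cV[R]_d * 'cV[R]_d -> R)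
    (S : 'cV[R]_d -> 'cV[R]_d) (K : R -> 'M[R]_d) (u : R -> 'cV[R]_d) (t : R) :
  kernel_conv K (S \o shift_by t u) 0 = kernel_conv K (S \o u) t ->
  Hamiltonian E S K (shift_by t u) =
  - (E (u t, derive1 u t) - dotp (grad_v E (u t) (derive1 u t)) (derive1 u t))
  + (- (2^-1 * dotp (S (u t)) (kernel_conv K (S \o u) t)) +
     2^-1 * \int[(@lebesgue_measure R \x @lebesgue_measure R)%E]_(z in quadrant)
       (dotp (S (u (z.1 + t)))
          (K (z.1 - z.2) *m (jac S (u (z.2 + t)) *m derive1 u (z.2 + t)))
        - dotp (S (u (z.2 + t)))
          (K (z.1 - z.2) *m (jac S (u (z.1 + t)) *m derive1 u (z.1 + t))))).
Proof.
move=> convE; rewrite /Hamiltonian convE derive1_shift_by.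
have -> : shift_by t u 0 = u t by rewrite /shift_by (add0r t).
have -> : shift_by t (derive1 u) 0 = derive1 u t by rewrite /shift_by (add0r t).
have opprDA (a c D : R) : - (a + c) + D = - a + (- c + D).
  by rewrite opprD addrA.
exact: opprDA.
Qed.

Theorem corollary3p1 (R : realType) (d : nat)
    (K : R -> 'M[R]_d) (S : 'cV[R]_d -> 'cV[R]_d)
    (E : 'cV[R]_d * 'cV[R]_d -> R) (u : R -> 'cV[R]_d)
    (hK : kernel_hyp K)
    (hS : class_C 2 S)
    (hE : class_C 2 E)
    (hu : class_Cb (regE E) u)
    (hsol : solves E S K u) :
  forall tau : R,
    is_derive tau 1 (fun t : R => Hamiltonian E S K (shift_by t u)) 0.
Proof.
move=> t.
have [ud cdu ub] := class_Cb1 hu.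
have huP (x : R) : is_derive x 1 u (derive1 u x).
  exact: is_derive_derive1 (ud 0%N x isT).
have cu : continuous u.
  by apply: derivable1_continuous => x; exact: (ud 0%N x).
have dS x : differentiable S x by case: hS.
pose s x := S (u x); pose ds x := jac S (u x) *m derive1 u x.
have sP (x : R) : is_derive x 1 s (ds x).
  by rewrite /ds jac_mulmx//; exact: is_derive_comp_diff.
have [C sdsC] := field_bounds hS (ub 0%N isT) (ub 1%N isT).
have sC i x : `|s x i 0| <= C by have [] := sdsC i x.
have dsC i x : `|ds x i 0| <= C by have [] := sdsC i x.
have cds i : continuous (fun x => ds x i 0).
  exact: field_velocity_continuous.
have convE x : kernel_conv K (S \o shift_by x u) 0 = kernel_conv K (S \o u) x.
  have [KN _ iK _] := hK.
  have cs j : continuous (fun y => s y j 0).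
    by move=> y; exact: is_derive_continuous (is_derive_coord j 0 (sP y)).
  apply/colP => i.
  have csx j : continuous (fun y => s (y + x) j 0).
    exact: (@continuous_translate R (fun y => s y j 0) x (cs j)).
  have sxC j y : `|s (y + x) j 0| <= C by exact: sC.
  rewrite (@kernel_conv_correlation _ _ K (S \o shift_by x u) C 0 i iK KN csx sxC).
  rewrite (@kernel_conv_correlation _ _ K (S \o u) C x i iK KN cs sC).
  apply: eq_bigr => j _; apply: eq_Rintegral => r _.
  by rewrite /= /shift_by add0r [r + x]addrC.
have dL := is_deriveN (is_derive_local t hE hu).
have dN := is_derive_nonlocal hK sP cds sC dsC t.
move: (is_deriveD dL dN); set H := (X in is_derive _ _ X _).
have -> : H = fun x => Hamiltonian E S K (shift_by x u).
  by apply/funext => x; rewrite Hamiltonian_shift.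
move=> dH; apply: is_derive_eq dH _.
(* The equation at t, paired with u' t, evaluates the local part. *)
have := hsol t => /(congr1 (fun v => dotp v (derive1 u t))).
rewrite dotpDl dotp0l => /eqP; rewrite addr_eq0 => /eqP ->.
by rewrite opprK dotp_mulmx_trmx subrr.
Qed.
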